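(* Let $a,c$ be nonzero complex numbers and let $\ell,m,n$ be nonnegative integers with $m\le n$. Then $$ {}_4\phi_3\left[\begin{matrix}a,\,q^{1+\ell}/a,\,q^{-n},\,-q^{m-n}\\ c,\,q^{1+\ell+m-2n}/c,\,-q\end{matrix};q,q\right] =\frac{(q^{2}/(ac),\,-q/a;q)_\ell}{(q^{2}/a^2,\,-q/c;q)_\ell}\, \frac{(q^{1-m+n},\,-q^{-\ell}c;q)_n}{(q^{n-m-\ell}c,\,-q;q)_n}\sum_{i=0}^{\ell}\sum_{j=0}^{m}T_{i,j}, $$ where $$ T_{i,j}=q^{(\ell+1)i+(m-n)j+\binom{j+1}{2}}\,\frac{(-1)^i}{c^i}\,\frac{1-q^{1+2i}/a^2}{1-q/a^2}\, \frac{(q^{-\ell},\,c/a,\,q/a^2;q)_i}{(q,\,q^2/(ac),\,q^{2+\ell}/a^2;q)_i} $$ $$ \times\frac{(q^{-m},\,q^{-n},\,-q^{-n},\,q^{-i-1}ac,\,q^{i}c/a;q)_j}{(q,\,c,\,-c,\,q^{m-2n},\,q^{j-2n-1};q)_j}\, \frac{(q^{j-i}ac,\,q^{1+i+j}c/a;q^2)_{n-j}}{(q,\,q^{2j}c^2;q^2)_{n-j}}. $$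
   Context: $q$ is a nonzero complex number. For complex $x$ and an integer $n\ge 0$, the $q$-shifted factorial is $(x;q)_0=1$, $(x;q)_n=\prod_{k=0}^{n-1}(1-xq^k)$, and $(x_1,\dots,x_r;q)_n=\prod_{s=1}^r (x_s;q)_n$ (likewise with base $q^2$ in place of $q$). The basic hypergeometric series is ${}_4\phi_3\left[\begin{matrix}a_0,a_1,a_2,a_3\\ b_1,b_2,b_3\end{matrix};q,z\right]=\sum_{k\ge0}\frac{(a_0,a_1,a_2,a_3;q)_k}{(q,b_1,b_2,b_3;q)_k}z^k$. Here one upper parameter is $q^{-n}$, so the series terminates and means the sum over $0\le k\le n$. Parameters are assumed to be such that no zero factor appears in a denominator of the displayed expressions. *)

(* Defs.v *)
From HB Require Import structures.
From mathcomp Require Import all_boot all_order all_algebra.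
From mathcomp Require Import reals complex.

Set Implicit Arguments.
Unset Strict Implicit.
Unset Printing Implicit Defensive.

Import GRing.Theory.
Local Open Scope ring_scope.

Section BasicHypergeometric.
Variable F : fieldType.

(* (x; q)_n *)
Definition qpoch (x q : F) (n : nat) : F := \prod_(k < n) (1 - x * q ^+ k).

(* (x_1, ..., x_r; q)_n *)
Definition qpochs (xs : seq F) (q : F) (n : nat) : F :=
  \prod_(x <- xs) qpoch x q n.

(* The 4phi3 series summed over 0 <= k <= N; this is the whole series when one
   of a0, ..., a3 is q^(-N), since (q^(-N); q)_k = 0 for k > N. *)
Definition phi43 (N : nat) (a0 a1 a2 a3 b1 b2 b3 q z : F) : F :=
  \sum_(k < N.+1)
    qpochs [:: a0; a1; a2; a3] q k / qpochs [:: q; b1; b2; b3] q k * z ^+ k.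

(* T_{i,j}; the exponents of q are integers, possibly negative. *)
Definition Tterm (q a c : F) (l m n i j : nat) : F :=
  q ^ ((l%:Z + 1) * i%:Z + (m%:Z - n%:Z) * j%:Z + 'C(j.+1, 2)%:Z)
  * ((- 1) ^+ i / c ^+ i)
  * ((1 - q ^+ (1 + 2 * i) / a ^+ 2) / (1 - q / a ^+ 2))
  * (qpochs [:: q ^ (- l%:Z); c / a; q / a ^+ 2] q i
     / qpochs [:: q; q ^+ 2 / (a * c); q ^+ (2 + l) / a ^+ 2] q i)
  * (qpochs [:: q ^ (- m%:Z); q ^ (- n%:Z); - q ^ (- n%:Z);
                q ^ (- i%:Z - 1) * a * c; q ^+ i * c / a] q j
     / qpochs [:: q; c; - c; q ^ (m%:Z - 2 * n%:Z);
                  q ^ (j%:Z - 2 * n%:Z - 1)] q j)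
  * (qpochs [:: q ^ (j%:Z - i%:Z) * a * c; q ^+ (1 + i + j) * c / a]
            (q ^+ 2) (n - j)
     / qpochs [:: q; q ^+ (2 * j) * c ^+ 2] (q ^+ 2) (n - j)).

End BasicHypergeometric.

(* Main.v *)
Require Import Defs.
From HB Require Import structures.
From mathcomp Require Import all_boot all_order all_algebra.
From mathcomp Require Import reals complex.
From mathcomp Require Import ring zify.

(* Sears' transformation with the fixed upper parameter -q^(m-n) turns the series into
   a multiple of
     4phi3[q^-n, -q^(m-n), c/a, ac/q^(l+1); c, q^(m-2n), -q^(-l) c; q, q].
   Two instances of one very-well-poised 6phi5 sum then remove l and m. The first writes
   (c/a, ac/q^(l+1))_k / (-q^(-l) c)_k as a combination over i of
   (q^i c/a, ac/q^(i+1))_k / (-c)_k; the second writes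
   (-q^(m-n))_k / (q^(m-2n))_k as a combination over j of terms that shift the summation
   index by j. What remains is the series with l = m = 0 and parameters n - j, c q^j,
   a q^-i, which Andrews' q-Watson sum evaluates. *)

Set Implicit Arguments.
Unset Strict Implicit.
Unset Printing Implicit Defensive.

Import GRing.Theory.
Local Open Scope ring_scope.

Section QSeries.
Variable F : fieldType.
Implicit Types q x y z : F.

Lemma qpoch0 x q : qpoch x q 0 = 1.
Proof. exact: big_ord0. Qed.

Lemma qpochS x q n : qpoch x q n.+1 = qpoch x q n * (1 - x * q ^+ n).
Proof. exact: big_ord_recr. Qed.

Lemma qpochD x q m n : qpoch x q (m + n) = qpoch x q m * qpoch (x * q ^+ m) q n.
Proof.
elim: n => [|n IHn]; first by rewrite addn0 qpoch0 mulr1.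
by rewrite addnS !qpochS IHn exprD !mulrA.
Qed.

Lemma qpochSl x q n : qpoch x q n.+1 = (1 - x) * qpoch (x * q) q n.
Proof. by rewrite -add1n qpochD expr1 qpochS qpoch0 mul1r expr0 mulr1. Qed.

Lemma qpoch_neq0P x q n :
  reflect (forall r, (r < n)%N -> 1 - x * q ^+ r != 0) (qpoch x q n != 0).
Proof.
apply: (iffP idP) => [/prodf_neq0 h r rn|h]; first exact: (h (Ordinal rn)).
by apply/prodf_neq0 => i _; apply: h.
Qed.

Lemma qpoch_neq0W x q m n : (m <= n)%N -> qpoch x q n != 0 -> qpoch x q m != 0.
Proof.
by move=> mn /qpoch_neq0P h; apply/qpoch_neq0P => r rm; exact: h (leq_trans rm mn).
Qed.

Lemma qpoch_sqr x q n : qpoch x q n * qpoch (- x) q n = qpoch (x ^+ 2) (q ^+ 2) n.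
Proof.
rewrite /qpoch -big_split; apply: eq_bigr => k _ /=.
by rewrite -exprM mulnC exprM; ring.
Qed.

(** The last [k] factors are turned round one by one: [1 - y q^(n-1-s) = - y q^(n-1-s) (1 - z q^s)]
    for [z = q^(1-n) / y]. Tying [z] to [y] by an equation keeps the identity free of inverses. *)
Lemma qpoch_rev q y z n k : (k <= n)%N -> z * y * q ^+ n = q ->
  qpoch y q n * q ^+ 'C(k.+1, 2)
  = qpoch y q (n - k) * (- (y * q ^+ n)) ^+ k * qpoch z q k.
Proof.
move=> + zy; elim: k => [_|k IHk kn].
  by rewrite subn0 bin_small // !expr0 qpoch0 !mulr1.
rewrite binS bin1. rewrite exprD mulrA (IHk (ltnW kn)) -[(n - k)%N]prednK ?subn_gt0 //.
rewrite -subnS !qpochS !exprS.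
have [d nE] : exists d, n = (k + d).+1 by exists (n - k.+1)%N; lia.
move: zy; rewrite nE (_ : (_ - _)%N = d); last by lia.
rewrite exprS exprD => /(congr1 (fun t => t * q ^+ k)) zy.
have {}zy : z * q ^+ k * (y * (q * (q ^+ k * q ^+ d))) = q * q ^+ k.
  by rewrite -zy; ring.
move: zy; set Q := q ^+ k => zy; ring: zy.
Qed.

(** A vanishing factor [1 + s q^r] forces [s^2 q^(2r) = 1], and [2r] stays below [2l - 1]. *)
Lemma qpoch_opp_neq0 q s l :
  (forall r, (r.+1 < l.*2)%N -> 1 - s ^+ 2 * q ^+ r != 0) -> qpoch (- s) q l != 0.
Proof.
move=> h; apply/qpoch_neq0P => r rl; apply: contraNneq (h r.*2 _).
  move=> /eqP; rewrite subr_eq0 eq_sym => /eqP e.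
  by rewrite -addnn exprD -[s ^+ 2]sqrrN expr2 mulrACA !e mulr1 subrr.
by rewrite -doubleS leq_double.
Qed.

(** * Telescoping and the basic summations *)

(* Zeilberger's method: [G] is the antidifference certificate. It is indexed so that
   [G j] is the sum of the first [j + 1] differences, hence needs no value at 0. *)
Lemma wz_step n (c1 c0 : F) (t1 t0 G : nat -> F) :
  c1 * t1 0 - c0 * t0 0 = G 0 ->
  (forall j, (j < n)%N -> c1 * t1 j.+1 - c0 * t0 j.+1 = G j.+1 - G j) ->
  c1 * t1 n.+1 = - G n ->
  c1 * \sum_(j < n.+2) t1 j = c0 * \sum_(j < n.+1) t0 j.
Proof.
move=> G0 GS Gn; rewrite big_ord_recr /= mulrDr Gn.
suff H m : (m <= n)%N ->
    c1 * \sum_(j < m.+1) t1 j - c0 * \sum_(j < m.+1) t0 j = G m.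
  by apply/eqP; rewrite -subr_eq0 addrAC H // subrr.
elim: m => [_|m IHm mn]; first by rewrite !big_ord1.
rewrite big_ord_recr [in X in _ - X]big_ord_recr /= -[RHS](subrK (G m)) -GS //.
by rewrite -(IHm (ltnW mn)); ring.
Qed.

Lemma sum_triangle n (f : nat -> nat -> F) :
  \sum_(k < n.+1) \sum_(j < k.+1) f j (k - j)%N
  = \sum_(j < n.+1) \sum_(p < (n - j).+1) f j p.
Proof.
elim: n => [|n IHn]; first by rewrite !big_ord1.
rewrite big_ord_recr IHn /= [in RHS]big_ord_recr /= subnn.
rewrite [in X in _ + X]big_ord_recr /= subnn addrA -big_split /=.
congr (_ + _); last by rewrite big_ord1.
apply: eq_bigr => j _; rewrite subSn; last by rewrite -ltnS.
by rewrite [RHS]big_ord_recr.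
Qed.

(* The q-Pfaff-Saalschutz sum, with the factors containing [q^-k] written through
   [(u; q)_{k-j}], which leaves no condition on [u]. *)
Lemma saalschutz q x z u k : qpoch q q k != 0 -> qpoch (x * z * u) q k != 0 ->
  \sum_(j < k.+1) qpoch x q j * qpoch z q j / (qpoch q q j * qpoch (x * z * u) q j)
      * (qpoch u q (k - j) / qpoch q q (k - j)) * u ^+ j
  = qpoch (x * u) q k * qpoch (z * u) q k / (qpoch q q k * qpoch (x * z * u) q k).
Proof.
set D := x * z * u.
elim: k => [|k IHk]; first by rewrite big_ord1 !qpoch0 expr0 !(mulr1, divr1).
rewrite qpochS [qpoch D _ _]qpochS => qk Dk.
move: (qk) (Dk); rewrite !mulf_eq0 !negb_or => /andP[qk0 qk1] /andP[Dk0 Dk1].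
have c1 : (1 - q * q ^+ k) * (1 - D * q ^+ k) != 0 by rewrite mulf_neq0.
apply: (mulfI c1); pose t k' j := qpoch x q j * qpoch z q j / (qpoch q q j * qpoch D q j)
      * (qpoch u q (k' - j) / qpoch q q (k' - j)) * u ^+ j.
(* The quotient of consecutive right-hand sides gives [c0 / c1]. The certificate is
   [- (1 - x q^j) (1 - z q^j) u q^(k-j)] times the summand [t k j]. *)
have -> := wz_step (n := k) (c0 := (1 - x * u * q ^+ k) * (1 - z * u * q ^+ k)) (t1 := t k.+1) (t0 := t k)
  (G := fun j => - (qpoch x q j.+1 * qpoch z q j.+1 / (qpoch q q j * qpoch D q j)
    * (qpoch u q (k - j) / qpoch q q (k - j)) * u ^+ j.+1 * q ^+ (k - j))).
- rewrite (IHk qk0 Dk0) !qpochS; field.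
  by rewrite qk0 Dk0 qk1 Dk1.
- rewrite /t !subn0 !qpochS !qpoch0 /D; field.
  by rewrite qk0 oner_neq0 qk1.
- move=> j jk; have [d kE] : exists d, k = (j.+1 + d)%N by exists (k - j.+1)%N; rewrite subnKC.
  have [qj Dj] : qpoch q q j.+1 != 0 /\ qpoch D q j.+1 != 0.
    by split; [apply: qpoch_neq0W qk0|apply: qpoch_neq0W Dk0].
  have qd : qpoch q q d.+1 != 0 by apply: qpoch_neq0W qk0; rewrite kE ltnS leq_addl.
  rewrite /t kE -addnS !subSS !addKn addSnnS !addKn.
  move: qj Dj qd qk1 Dk1.
  rewrite !qpochS !exprS kE !exprD !exprS.
  rewrite !mulf_eq0 !negb_or => /andP[qj qj1] /andP[Dj Dj1] /andP[qd qd1] _ _.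
  rewrite /D in Dj1 *.
  by field; rewrite qd qd1 qj qj1 Dj1 Dj.
- rewrite /t !subnn !qpoch0 !qpochS.
  by field; rewrite oner_neq0 qk0 Dk0 qk1 Dk1.
Qed.

(* Andrews' terminating q-analogue of Watson's sum, cleared of [q^-n]. *)
Lemma qwatson q a b n : qpoch (q ^+ 2) (q ^+ 2) n != 0 ->
    qpoch (a * b * q) (q ^+ 2) n != 0 ->
  \sum_(k < n.+1) q ^+ 'C(k.+1, 2) * qpoch a q k * qpoch b q k
      * qpoch q q (n.*2 - k)
      / (qpoch q q k * qpoch (a * b * q) (q ^+ 2) k * qpoch (q ^+ 2) (q ^+ 2) (n - k))
  = qpoch (a * q) (q ^+ 2) n * qpoch (b * q) (q ^+ 2) n
    / qpoch (a * b * q) (q ^+ 2) n.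
Proof.
elim: n => [|n IHn].
  by rewrite big_ord1 !qpoch0 bin_small // expr0 !(mulr1, divr1).
rewrite ![qpoch _ _ n.+1]qpochS => q2n Dn.
move: (q2n) (Dn); rewrite !mulf_eq0 !negb_or.
move=> /andP[q2n0 q2n1] /andP[Dn0 Dn1].
have qn0 : qpoch q q n != 0.
  by move: q2n0; rewrite -qpoch_sqr mulf_eq0 negb_or => /andP[].
have qn1 : 1 - q * q ^+ n != 0.
  apply: contraNneq q2n1 => /eqP; rewrite subr_eq0 => /eqP Q.
  by rewrite -exprM mulnC exprM -exprMn -Q expr1n subrr.
have Qe r : (q ^+ 2) ^+ r = q ^+ r * q ^+ r by rewrite -exprM mul2n -addnn exprD.
apply: (mulfI Dn1).
pose t n j := q ^+ 'C(j.+1, 2) * qpoch a q j * qpoch b q j * qpoch q q (n.*2 - j)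
    / (qpoch q q j * qpoch (a * b * q) (q ^+ 2) j * qpoch (q ^+ 2) (q ^+ 2) (n - j)).
(* The certificate is [- q^(2n+1-j) (1 - a q^j) (1 - b q^j)] times [t n j]; writing it with
   ['C(j, 2)] absorbs the [-j] in the exponent. *)
have -> := wz_step (n := n) (c0 := (1 - a * q * (q ^+ 2) ^+ n) * (1 - b * q * (q ^+ 2) ^+ n))
  (t1 := t n.+1) (t0 := t n)
  (G := fun j => - (q ^+ (n.*2.+1 + 'C(j, 2)) * qpoch a q j.+1 * qpoch b q j.+1
    * qpoch q q (n.*2 - j)
    / (qpoch q q j * qpoch (a * b * q) (q ^+ 2) j * qpoch (q ^+ 2) (q ^+ 2) (n - j)))).
- rewrite (IHn q2n0 Dn0); field.
  by rewrite Dn0 Dn1.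
- rewrite /t !subn0 doubleS !qpochS !qpoch0 !bin_small // addn0.
  have -> : q ^+ n.*2.+1 = q * q ^+ n * q ^+ n by rewrite exprS -addnn exprD mulrA.
  have -> : q ^+ n.*2 = q ^+ n * q ^+ n by rewrite -addnn exprD.
  move: q2n1; rewrite Qe expr0 => q2n1; field.
  by rewrite q2n0 q2n1.
- move=> j jn; have [d nE] : exists d, n = (j.+1 + d)%N.
    by exists (n - j.+1)%N; rewrite subnKC.
  have [qj Dj] : qpoch q q j.+1 != 0 /\ qpoch (a * b * q) (q ^+ 2) j.+1 != 0.
    by split; [apply: qpoch_neq0W qn0|apply: qpoch_neq0W Dn0].
  have qd : qpoch (q ^+ 2) (q ^+ 2) d.+1 != 0.
    by apply: qpoch_neq0W q2n0; rewrite nE ltnS leq_addl.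
  have e1 : (n.+1.*2 - j.+1 = (j + d.*2).+3)%N by rewrite nE; clear; lia.
  have e2 : (n.*2 - j.+1 = (j + d.*2).+1)%N by rewrite nE; clear; lia.
  have e3 : (n.*2 - j = (j + d.*2).+2)%N by rewrite nE; clear; lia.
  have e4 : (n.*2.+1 = (j.*2 + d.*2).+3)%N by rewrite nE; clear; lia.
  have e5 : (n.+1 - j.+1 = d.+1)%N by rewrite nE; clear; lia.
  have e6 : (n - j = d.+1)%N by rewrite nE; clear; lia.
  have e7 : (n - j.+1 = d)%N by rewrite nE; clear; lia.
  rewrite /t e1 e2 e3 e4 e5 e6 e7 {e1 e2 e3 e4 e5 e6 e7} nE.
  rewrite (_ : 'C(j.+2, 2) = 'C(j.+1, 2) + j.+1)%N; last by rewrite binS bin1.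
  rewrite (_ : 'C(j.+1, 2) = 'C(j, 2) + j)%N; last by rewrite binS bin1.
  move: ('C(j, 2)) => C.
  have Qd : q ^+ d.*2 = q ^+ d * q ^+ d by rewrite -addnn exprD.
  have Qj : q ^+ j.*2 = q ^+ j * q ^+ j by rewrite -addnn exprD.
  move: qj Dj qd.
  rewrite !qpochS !(exprD, Qe).
  (* Hiding [q ^+ 2] keeps the expansion of powers below from touching the base of the
     [q^2]-factorials. *)
  have [q2 q2E] : exists q2, q2 = q ^+ 2 by exists (q ^+ 2).
  rewrite -!q2E ![q ^+ _.+1]exprS !(exprD, Qd, Qj).
  rewrite !mulf_eq0 !negb_or.
  move=> /andP[qj qj1] /andP[Dj Dj1] /andP[qd qd1].
  move: qj qj1 Dj Dj1 qd qd1.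
  set Q := q ^+ j; set P := q ^+ d; set X := qpoch q2 _ _.
  clear -q2E.
  set A := qpoch a q j; set B := qpoch b q j.
  set E := qpoch q q j; set E' := qpoch q q (j + _).
  set D := qpoch _ q2 j. set C' := q ^+ C.
  move: A B E E' D C' X P Q => A B E E' D C' X P Q.
  move=> qj qj1 Dj Dj1 qd; rewrite q2E => qd1.
  by field; rewrite qd qd1 qj qj1 Dj1 Dj.
- rewrite /t !subnn !qpoch0 -!addnn !addnK !qpochS.
  rewrite (_ : 'C(n.+2, 2) = 'C(n, 2) + n + n.+1)%N; last by rewrite !binS !bin1 bin0 addn1.
  rewrite Qe in Dn1 *; rewrite !exprD [q ^+ n.+1]exprS [q ^+ (n + n).+1]exprS !exprD.
  field.
  by rewrite qn0 Dn0 qn1 Dn1.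
Qed.

(* The terminating very-well-poised 6phi5 sum with [A q = s^2] and [f = - s], for
   which [(f)_i / (A q / f)_i = 1]. It is cleared of the quotients by [1 - A] and
   [e = 1 / y], so that it survives at the zeros of these. *)
Lemma well_poised_sum q A s y l : s ^+ 2 = A * q -> qpoch q q l != 0 ->
    (forall r, (r.+1 < l.*2)%N -> 1 - s ^+ 2 * q ^+ r != 0) ->
  \sum_(i < l.+1) q ^+ 'C(i, 2) * s ^+ i * \prod_(r < i) (y - q ^+ r)
      * qpoch (s ^+ 2 * q ^+ i * y) q (l - i)
      / (qpoch q q i * qpoch q q (l - i)
         * (qpoch (A * q ^+ i) q i * qpoch (A * q ^+ (i.*2.+1)) q (l - i)))
  = qpoch (- s * y) q l / (qpoch q q l * qpoch (- s) q l).
Proof.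
move=> As; elim: l => [|l IHl].
  by rewrite big_ord1 !qpoch0 big_ord0 expr0 !(mulr1, divr1).
rewrite ![qpoch _ _ l.+1]qpochS => ql Al.
have := qpoch_opp_neq0 Al; rewrite qpochS => sl.
move: (ql) (sl); rewrite !mulf_eq0 !negb_or => /andP[ql0 ql1] /andP[sl0 sl1].
have AN r : (r.+1 < l.+1.*2)%N -> 1 - A * q ^+ r.+1 != 0.
  by rewrite exprS mulrA -As => /Al.
have c1 : (1 - q * q ^+ l) * (1 - - s * q ^+ l) != 0 by rewrite mulf_neq0.
apply: (mulfI c1).
(* The two factorials in [A] make up [(A q^i; q)_(l+1)] without its factor [1 - A q^(2i)]: this gap
   is the very-well-poised factor of the numerator. *)
pose t l i := q ^+ 'C(i, 2) * s ^+ i * \prod_(r < i) (y - q ^+ r)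
      * qpoch (s ^+ 2 * q ^+ i * y) q (l - i)
      / (qpoch q q i * qpoch q q (l - i)
         * (qpoch (A * q ^+ i) q i * qpoch (A * q ^+ (i.*2.+1)) q (l - i))).
have -> := wz_step (n := l) (c0 := 1 - - s * y * q ^+ l)
  (t1 := t l.+1) (t0 := t l)
  (G := fun j => - ((1 + s * q ^+ j) * q ^+ (l - j) * q ^+ 'C(j.+1, 2) * s ^+ j.+1
    * \prod_(r < j.+1) (y - q ^+ r) * qpoch (s ^+ 2 * q ^+ j * y) q (l - j)
    / (qpoch q q j * qpoch q q (l - j) * qpoch (A * q ^+ j.+1) q l.+1))).
- rewrite IHl //; first by field; rewrite sl1 sl0 ql1 ql0.
  by move=> r rl; apply: Al; apply: leq_trans rl _; rewrite leq_double.
- rewrite /t !subn0 !qpochS !qpoch0 big_ord1 big_ord0 bin_small // -As.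
  have : qpoch (s ^+ 2) q l.+1 != 0.
    apply/qpoch_neq0P => r rl; apply: Al; rewrite doubleS !ltnS -addnn.
    exact: leq_trans (rl : (r <= l)%N) (leq_addr _ _).
  rewrite qpochS mulf_eq0 negb_or => /andP[A0 A1].
  rewrite !(expr1, expr0, mulr1); field.
  by rewrite A1 A0 ql0 ql1.
- move=> j jl; have [d lE] : exists d, l = (j.+1 + d)%N.
    by exists (l - j.+1)%N; rewrite subnKC.
  rewrite /t subSS (_ : l - j.+1 = d)%N; last by rewrite lE addKn.
  rewrite (_ : l - j = d.+1)%N; last by rewrite lE addSnnS addKn.
  rewrite doubleS.
  set X := qpoch (A * q ^+ j.+1) q j.+1; set Y := qpoch (A * q ^+ j.*2.+3) q d.
  have Xn : X != 0.
    apply/qpoch_neq0P => r rj; rewrite -mulrA -exprD addSn; apply: AN.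
    by rewrite lE; clear -rj; lia.
  have Yn : Y != 0.
    apply/qpoch_neq0P => r rd; rewrite -mulrA -exprD addSn; apply: AN.
    by rewrite lE; clear -rd; lia.
  (* The denominators of both summands at [j + 1] and of [G] at [j] and [j + 1] are all written
     through [X], [Y] and the three single factors of [N1], [N2], [N3]. *)
  have E1 : qpoch (A * q ^+ j.+1) q l.+1 = X * ((1 - A * q ^+ j.*2.+2) * Y).
    rewrite lE -addnS qpochD; congr (_ * _).
    by rewrite qpochSl -mulrA -exprD addnn -mulrA -exprSr.
  have E2 : (1 - A * q ^+ j.+1) * qpoch (A * q ^+ j.+2) q l.+1
     = X * ((1 - A * q ^+ j.*2.+2) * Y) * (1 - A * q ^+ (j.*2.+3 + d)).
    rewrite -E1 [q ^+ j.+2]exprSr mulrA -qpochSl qpochS; congr (_ * (1 - _)).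
    rewrite -mulrA -exprD; congr (_ * _ ^+ _); rewrite lE; clear; lia.
  have N1 : 1 - A * q ^+ j.+1 != 0 by apply: AN; rewrite lE; clear; lia.
  have N2 : 1 - A * q ^+ j.*2.+2 != 0 by apply: AN; rewrite lE; clear; lia.
  have N3 : 1 - A * q ^+ (j.*2.+3 + d) != 0.
    by rewrite !addSn; apply: AN; rewrite lE; clear; lia.
  have {}E2 : qpoch (A * q ^+ j.+2) q l.+1
     = X * ((1 - A * q ^+ j.*2.+2) * Y) * (1 - A * q ^+ (j.*2.+3 + d))
       / (1 - A * q ^+ j.+1) by rewrite -E2 mulrAC divff ?mul1r.
  rewrite {}E1 {}E2 [qpoch (A * _) q d.+1]qpochS -/Y.
  rewrite [qpoch (s ^+ 2 * q ^+ j * y) _ _]qpochSl.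
  rewrite (_ : s ^+ 2 * q ^+ j * y * q = s ^+ 2 * q ^+ j.+1 * y); last by rewrite [q ^+ j.+1]exprS; ring.
  rewrite [qpoch (_ * y) q d.+1]qpochS; set Z := qpoch (s ^+ 2 * q ^+ j.+1 * y) q d.
  rewrite [in X in _ = - X - _]big_ord_recr /=.
  set R := \prod_(r < j.+1) _.
  rewrite (_ : 'C(j.+2, 2) = 'C(j.+1, 2) + j.+1)%N; last by rewrite binS bin1.
  have qj : qpoch q q j.+1 != 0 by apply: qpoch_neq0W ql0; rewrite lE leq_addr.
  have qd : qpoch q q d.+1 != 0.
    by apply: qpoch_neq0W ql0; rewrite lE addSn ltnS leq_addl.
  move: N1 N2 N3 Xn Yn qj qd; rewrite lE !qpochS.
  move: R X Y Z ('C(j.+1, 2)) => R X Y Z C.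
  have Ej : q ^+ j.+1 = q * q ^+ j by rewrite exprS.
  have E2j : q ^+ j.*2.+2 = q ^+ 2 * (q ^+ j) ^+ 2.
    by rewrite -exprM -exprD; congr (_ ^+ _); clear; lia.
  have E5 : q ^+ j.*2.+3 = q ^+ 3 * (q ^+ j) ^+ 2.
    by rewrite -exprM -exprD; congr (_ ^+ _); clear; lia.
  have E3 : q ^+ (j.*2.+3 + d) = q ^+ 3 * (q ^+ j) ^+ 2 * q ^+ d.
    by rewrite -exprM -!exprD; congr (_ ^+ _); clear; lia.
  have E4 : q ^+ d.+1 = q * q ^+ d by rewrite exprS.
  rewrite E2j E3 E5 ![q ^+ (_ + _)]exprD E4 Ej [s ^+ j.+2]exprS.
  rewrite !mulf_eq0 !negb_or.
  move: (qpoch q q j) (qpoch q q d) (q ^+ C) (q ^+ j) (q ^+ d) (s ^+ j.+1).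
  clear -As => J D C' P Q S N1 N2 N3 Xn Yn /andP[qj qj1] /andP[qd qd1].
  rewrite -exprMn in N2 *.
  by field: As; rewrite Xn Yn qj qj1 qd qd1 N1 N2 N3.
- rewrite /t !subnn !qpoch0.
  have Xn : qpoch (A * q ^+ l.+1) q l.+1 != 0.
    apply/qpoch_neq0P => r rl; rewrite -mulrA -exprD addSn; apply: AN.
    by clear -rl; lia.
  move: Xn; move: (qpoch (A * _) q l.+1) => X Xn; rewrite qpochS.
  by field; rewrite Xn ql0 ql1.
Qed.

(** * Sears' transformation *)

(* Sears' transformation of balanced terminating 4phi3 series, in the same form:
   in the usual notation the series is
   4phi3[q^-n, a, xu, zu; xzu, auv, q^(1-n)/v; q, q]. *)
Lemma sears q a x z u v n : qpoch q q n != 0 ->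
    qpoch (x * z * u) q n != 0 -> qpoch (a * u * v) q n != 0 ->
  \sum_(k < n.+1) qpoch a q k * qpoch (x * u) q k * qpoch (z * u) q k
      / (qpoch q q k * qpoch (x * z * u) q k * qpoch (a * u * v) q k)
      * (qpoch v q (n - k) / qpoch q q (n - k)) * v ^+ k
  = \sum_(j < n.+1) qpoch x q j * qpoch z q j * qpoch a q j
      / (qpoch q q j * qpoch (x * z * u) q j) * (u * v) ^+ j
      * qpoch (a * v * q ^+ j) q (n - j) * qpoch (u * v) q (n - j)
      / (qpoch q q (n - j) * qpoch (a * u * v) q n).
Proof.
move=> qn Dn En.
have qj j : (j < n.+1)%N -> qpoch q q j != 0 by move=> jn; apply: qpoch_neq0W qn.
have Dj j : (j < n.+1)%N -> qpoch (x * z * u) q j != 0 by move=> jn; apply: qpoch_neq0W Dn.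
have Ej j : (j < n.+1)%N -> qpoch (a * u * v) q j != 0 by move=> jn; apply: qpoch_neq0W En.
(* Saalschutz is used twice. Read backwards with [x], [z], [u], it opens the [k]-th term into a sum
   over [j]; after the exchange, with [k = j + p], it closes the sum over [p] with [a q^j], [u],
   [v]. *)
pose f j p := qpoch x q j * qpoch z q j / (qpoch q q j * qpoch (x * z * u) q j)
   * (qpoch u q p / qpoch q q p) * u ^+ j
   * (qpoch a q (j + p) / qpoch (a * u * v) q (j + p)
      * (qpoch v q (n - (j + p)) / qpoch q q (n - (j + p))) * v ^+ (j + p)).
transitivity (\sum_(k < n.+1) \sum_(j < k.+1) f j (k - j)%N).
  apply: eq_bigr => -[k kn] _ /=.
  transitivity (qpoch (x * u) q k * qpoch (z * u) q k
      / (qpoch q q k * qpoch (x * z * u) q k) * (qpoch a q k / qpoch (a * u * v) q k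
      * (qpoch v q (n - k) / qpoch q q (n - k)) * v ^+ k)).
    field.
    by rewrite qj ?Ej ?Dj ?qj // ltnS leq_subr.
  rewrite -saalschutz ?qj ?Dj // mulr_suml; apply: eq_bigr => -[j jk] _ /=.
  by rewrite /f subnKC.
rewrite sum_triangle; apply: eq_bigr => -[j jn] _ /=.
set N := (n - j)%N.
have qN : qpoch q q N != 0 by apply: qpoch_neq0W qn; apply: leq_subr.
have nE : n = (j + N)%N by rewrite subnKC.
have EN : qpoch (a * q ^+ j * u * v) q N != 0.
  rewrite (_ : _ * v = a * u * v * q ^+ j); last by ring.
  by move: En; rewrite nE qpochD mulf_eq0 negb_or => /andP[].
have := saalschutz (q := q) (x := a * q ^+ j) (z := u) (u := v) (k := N) qN EN.
have Eq p : qpoch (a * u * v) q (j + p)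
    = qpoch (a * u * v) q j * qpoch (a * q ^+ j * u * v) q p.
  by rewrite qpochD; congr (_ * qpoch _ _ _); ring.
have -> : qpoch (a * u * v) q n = qpoch (a * u * v) q j * qpoch (a * q ^+ j * u * v) q N.
  by rewrite -Eq -nE.
rewrite (_ : a * q ^+ j * v = a * v * q ^+ j); last by ring.
move=> /(congr1 (fun t => qpoch x q j * qpoch z q j * qpoch a q j
  / (qpoch q q j * qpoch (x * z * u) q j * qpoch (a * u * v) q j) * (u * v) ^+ j * t)) H.
transitivity (qpoch x q j * qpoch z q j * qpoch a q j
  / (qpoch q q j * qpoch (x * z * u) q j * qpoch (a * u * v) q j) * (u * v) ^+ j
  * (qpoch (a * v * q ^+ j) q N * qpoch (u * v) q N
       / (qpoch q q N * qpoch (a * q ^+ j * u * v) q N))); last first.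
  by field; rewrite EN qN Ej // Dj // qj.
rewrite -H mulr_sumr; apply: eq_bigr => -[p pN] _ /=.
have qp : qpoch q q p != 0 by apply: qpoch_neq0W qN.
have qNp : qpoch q q (N - p) != 0 by apply: qpoch_neq0W qN; apply: leq_subr.
have Ep : qpoch (a * q ^+ j * u * v) q p != 0 by apply: qpoch_neq0W EN.
rewrite /f Eq qpochD subnDA -/N exprMn exprD.
by field; rewrite Ep qp qNp Ej // Dj // qj.
Qed.

(** * The q-Watson sum with [q^-n] restored, and the removal of [m] *)

Lemma prod_sub_expr q x y n : x * y = 1 ->
  \prod_(r < n) (y - q ^+ r) = y ^+ n * qpoch x q n.
Proof.
move=> xy; elim: n => [|n IHn]; first by rewrite big_ord0 qpoch0 mulr1.
by rewrite big_ord_recr qpochS /= IHn exprS; ring: xy.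
Qed.

Lemma qpoch_double q x n :
  qpoch x q n.*2 = qpoch x (q ^+ 2) n * qpoch (x * q) (q ^+ 2) n.
Proof.
elim: n => [|n IHn]; first by rewrite !qpoch0 mulr1.
rewrite doubleS !qpochS IHn -exprM mul2n [q ^+ n.*2.+1]exprS; ring.
Qed.

(** In [qwatson], [(w, -w; q)_k = (w^2; q^2)_k] is reversed in base [q^2] over length [n], and
    [(w^2; q)_k] in base [q] over length [2n]. Keeping [C] in base [q^2] avoids a square root of
    [a b q]. *)
Lemma qwatson_phi q a b C w n : w * q ^+ n = 1 -> a * b * q = C ->
    qpoch q q n.*2 != 0 -> qpoch C (q ^+ 2) n != 0 ->
  \sum_(k < n.+1) qpoch w q k * qpoch (- w) q k * qpoch a q k * qpoch b q k
      / (qpoch q q k * qpoch C (q ^+ 2) k * qpoch (w ^+ 2) q k) * q ^+ k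
  = qpoch (a * q) (q ^+ 2) n * qpoch (b * q) (q ^+ 2) n
    / (qpoch q (q ^+ 2) n * qpoch C (q ^+ 2) n).
Proof.
move=> wq <-{C} qn Dn.
(* For [n = 0] the equation for [w] does not force [q] to be nonzero. *)
have [q0|n0] := eqVneq n 0%N.
  by rewrite q0 big_ord1 !qpoch0 expr0 !(mulr1, divr1).
have qN0 : q != 0.
  by apply: contra_eqN wq => /eqP->; rewrite expr0n (negPf n0) mulr0 eq_sym oner_eq0.
move: (qn); rewrite qpoch_double mulf_eq0 negb_or -expr2 => /andP[qo qe].
rewrite [X in _ = _ / X]mulrC invfM mulrA -qwatson // mulr_suml.
apply: eq_bigr => -[k kn] _ /=.
have w2 : w ^+ 2 * q * q ^+ n.*2 = q.
  by rewrite -muln2 exprM -[X in _ = X]mulr1 -(expr1n _ 2) -wq; ring.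
have w2e : w ^+ 2 * q ^+ 2 * (q ^+ 2) ^+ n = q ^+ 2.
  by rewrite -exprM mulnC exprM -!exprMn mulrAC wq mul1r.
have kn2 : (k <= n.*2)%N by rewrite (leq_trans (kn : (k <= n)%N)) // -addnn leq_addr.
have := qpoch_rev kn2 w2; have := qpoch_rev (kn : (k <= n)%N) w2e.
rewrite qpoch_sqr -exprM [(2 * _)%N]mulnC exprM -muln2 exprM.
have qk : qpoch q q k != 0 by apply: qpoch_neq0W qn.
have Dk : qpoch (a * b * q) (q ^+ 2) k != 0 by apply: qpoch_neq0W Dn.
have ek : qpoch (q ^+ 2) (q ^+ 2) (n - k) != 0 by apply: qpoch_neq0W qe; apply: leq_subr.
have qk' : qpoch q q (n * 2 - k) != 0 by apply: qpoch_neq0W qn; rewrite muln2 leq_subr.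
have -> : (- (q ^+ 2 * (q ^+ 2) ^+ n)) ^+ k = q ^+ k * (- (q * (q ^+ n) ^+ 2)) ^+ k.
  by rewrite -exprMn -!exprM [(2 * n)%N]mulnC; congr (_ ^+ _); ring.
rewrite muln2 qpoch_double -expr2 -muln2.
set M := (- (q * _)) ^+ k; set c := q ^+ 'C(_, _).
have Mn : M != 0 by rewrite expf_neq0 // oppr_eq0 mulf_neq0 // !expf_neq0.
have Rn : q ^+ k != 0 by rewrite expf_neq0.
have cn : c != 0 by rewrite expf_neq0.
move=> e1 e2.
have -> : qpoch (w ^+ 2) (q ^+ 2) k
    = qpoch (q ^+ 2) (q ^+ 2) n * c ^+ 2 / (qpoch (q ^+ 2) (q ^+ 2) (n - k) * (q ^+ k * M)).
  by rewrite e1; field; rewrite ek Rn Mn.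
have -> : qpoch (w ^+ 2) q k
    = qpoch q (q ^+ 2) n * qpoch (q ^+ 2) (q ^+ 2) n * c / (qpoch q q (n * 2 - k) * M).
  by rewrite e2; field; rewrite qk' Mn.
field.
by rewrite ek qk qk' Dk Mn Rn cn qo qe.
Qed.

(* Expanding [(- q^m w)_k / (q^m w^2)_k] by the well-poised sum with [s = w = q^-n]
   reduces the series to the case [m = 0]. *)
Lemma phi_expand_m q a b C w x m n : w * q ^+ n = 1 -> x * q ^+ m = 1 ->
    (m <= n)%N -> a * b * q = C -> qpoch q q n.*2 != 0 -> qpoch C (q ^+ 2) n != 0 ->
  \sum_(k < n.+1) qpoch w q k * qpoch (- (q ^+ m * w)) q k * qpoch a q k * qpoch b q k
      / (qpoch q q k * qpoch C (q ^+ 2) k * qpoch (q ^+ m * w ^+ 2) q k) * q ^+ k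
  = \sum_(j < m.+1) (q ^+ m * w) ^+ j * q ^+ 'C(j.+1, 2)
      * (qpoch x q j * qpoch w q j * qpoch (- w) q j * qpoch a q j * qpoch b q j)
      / (qpoch q q j * qpoch C (q ^+ 2) j * qpoch (q ^+ m * w ^+ 2) q j
         * qpoch (w ^+ 2 / q * q ^+ j) q j)
      * (qpoch (a * q ^+ j.+1) (q ^+ 2) (n - j) * qpoch (b * q ^+ j.+1) (q ^+ 2) (n - j))
      / (qpoch q (q ^+ 2) (n - j) * qpoch (C * (q ^+ 2) ^+ j) (q ^+ 2) (n - j)).
Proof.
move=> wq xq mn abC qn Cn.
have [q0|n0] := eqVneq n 0%N.
  move: mn; rewrite q0 leqn0 => /eqP->.
  by rewrite !big_ord1 !qpoch0 !expr0 !(mulr1, divr1).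
have qN0 : q != 0.
  by apply: contra_eqN wq => /eqP->; rewrite expr0n (negPf n0) mulr0 eq_sym oner_eq0.
have wN0 : w != 0 by apply: contra_eqN wq => /eqP->; rewrite mul0r eq_sym oner_eq0.
(* Since [w^2 q^r = q^(r-2n)], a zero here would kill [1 - q^(2n-r)], a factor of [(q; q)_(2n)]. *)
have wr r : (r < n.*2)%N -> 1 - w ^+ 2 * q ^+ r != 0.
  move=> rn; have /(qpoch_neq0P _ _ _)/(_ (n.*2 - r.+1)%N) := qn.
  rewrite ltn_subrL (leq_ltn_trans _ rn) // -exprS -subSn // subSS => /(_ isT).
  apply: contraNneq => /eqP; rewrite !subr_eq0 => /eqP h.
  have /(congr1 (fun t => t ^+ 2)) := wq; rewrite exprMn expr1n -exprM muln2.
  by rewrite -(subnKC (ltnW rn)) exprD mulrA -h mul1r addKn => ->.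
have wmr r : (r < n)%N -> 1 - q ^+ m * w ^+ 2 * q ^+ r != 0.
  move=> rn; rewrite [q ^+ m * _]mulrC -mulrA -exprD; apply: wr.
  by rewrite -addnn -addnS leq_add.
have wj j : (j <= n)%N -> qpoch (w ^+ 2 / q * q ^+ j) q j != 0.
  move=> jn; apply/qpoch_neq0P => r rj.
  have -> : w ^+ 2 / q * q ^+ j * q ^+ r = w ^+ 2 * q ^+ (j.-1 + r).
    rewrite -[in q ^+ j](ltn_predK rj) [q ^+ _.+1]exprS [q ^+ (_ + _)]exprD; field.
    exact: qN0.
  by apply: wr; clear -jn rj; lia.
pose g j := (q ^+ m * w) ^+ j * q ^+ 'C(j.+1, 2)
      * (qpoch x q j * qpoch w q j * qpoch (- w) q j * qpoch a q j * qpoch b q j)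
      / (qpoch q q j * qpoch C (q ^+ 2) j * qpoch (q ^+ m * w ^+ 2) q j
         * qpoch (w ^+ 2 / q * q ^+ j) q j)
      * (qpoch (a * q ^+ j.+1) (q ^+ 2) (n - j) * qpoch (b * q ^+ j.+1) (q ^+ 2) (n - j))
      / (qpoch q (q ^+ 2) (n - j) * qpoch (C * (q ^+ 2) ^+ j) (q ^+ 2) (n - j)).
(* [(q^-m; q)_j] vanishes for [j > m], so the range can be extended to the one that the exchange of
   sums produces. *)
have -> : \sum_(j < m.+1) g j = \sum_(j < n.+1) g j.
  rewrite (big_ord_widen n.+1 g) ?ltnS // [RHS](bigID (fun j : 'I__ => (j < m.+1)%N)) /=.
  rewrite [X in _ = _ + X]big1 ?addr0 // => j; rewrite -leqNgt => mj.
  suff x0 : qpoch x q j = 0 by rewrite /g x0 !(mul0r, mulr0).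
  by apply/eqP; rewrite -(subnKC mj) qpochD qpochS xq subrr mulr0 mul0r.
pose A := w ^+ 2 / q.
pose f j p := qpoch w q (j + p) * qpoch (- w) q (j + p)
  * qpoch a q (j + p) * qpoch b q (j + p)
  / (qpoch C (q ^+ 2) (j + p) * qpoch (q ^+ m * w ^+ 2) q (j + p)) * q ^+ (j + p)
  * (q ^+ 'C(j, 2) * w ^+ j * \prod_(r < j) (q ^+ m - q ^+ r)
      * qpoch (w ^+ 2 * q ^+ j * q ^+ m) q p
      / (qpoch q q j * qpoch q q p
         * (qpoch (A * q ^+ j) q j * qpoch (A * q ^+ (j.*2.+1)) q p))).
have As : w ^+ 2 = A * q by rewrite /A divfK.
transitivity (\sum_(k < n.+1) \sum_(j < k.+1) f j (k - j)%N).
  apply: eq_bigr => -[k kn] _ /=.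
  have kn2 : (k <= n.*2)%N by rewrite (leq_trans (kn : (k <= n)%N)) // -addnn leq_addr.
  have qk : qpoch q q k != 0 by apply: qpoch_neq0W qn.
  have Ck : qpoch C (q ^+ 2) k != 0 by apply: qpoch_neq0W Cn.
  have wk : qpoch (- w) q k != 0.
    have : qpoch (w ^+ 2) (q ^+ 2) k != 0.
      apply/qpoch_neq0P => r rk; rewrite -exprM; apply: wr.
      by clear -rk kn; lia.
    by rewrite -qpoch_sqr mulf_eq0 negb_or => /andP[].
  have wmk : qpoch (q ^+ m * w ^+ 2) q k != 0.
    by apply/qpoch_neq0P => r rk; apply: wmr; apply: leq_trans rk _.
  transitivity (qpoch w q k * qpoch (- w) q k * qpoch a q k * qpoch b q k
    / (qpoch C (q ^+ 2) k * qpoch (q ^+ m * w ^+ 2) q k) * q ^+ k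
    * (qpoch (- w * q ^+ m) q k / (qpoch q q k * qpoch (- w) q k))).
    rewrite mulNr [w * _]mulrC; field.
    by rewrite qk Ck wk wmk.
  rewrite -(well_poised_sum _ As) //; last first.
    by move=> r rk; apply: wr; clear -rk kn; lia.
  by rewrite mulr_sumr; apply: eq_bigr => -[j jk] _ /=; rewrite /f subnKC.
rewrite sum_triangle; apply: eq_bigr => -[j jn] _ /=.
set N := (n - j)%N.
have nE : n = (j + N)%N by rewrite subnKC.
have qN : qpoch q q N.*2 != 0.
  by apply: qpoch_neq0W qn; rewrite leq_double leq_subr.
have CN : qpoch (C * (q ^+ 2) ^+ j) (q ^+ 2) N != 0.
  by move: Cn; rewrite nE qpochD mulf_eq0 negb_or => /andP[].
have wN : w * q ^+ j * q ^+ N = 1 by rewrite -mulrA -exprD -nE.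
have abN : a * q ^+ j * (b * q ^+ j) * q = C * (q ^+ 2) ^+ j.
  by rewrite -abC -exprM mulnC exprM; ring.
have H := qwatson_phi wN abN qN CN.
have qj : qpoch q q j != 0 by apply: qpoch_neq0W qn; clear -jn; lia.
have Cj : qpoch C (q ^+ 2) j != 0 by apply: qpoch_neq0W Cn.
have wmj : qpoch (q ^+ m * w ^+ 2) q j != 0.
  by apply/qpoch_neq0P => r rj; apply: wmr; apply: leq_trans rj _.
have Aj : qpoch (A * q ^+ j) q j != 0 by apply: wj.
have qoN : qpoch q (q ^+ 2) N != 0.
  by move: qN; rewrite qpoch_double mulf_eq0 negb_or => /andP[].
have C2 : 'C(j.+1, 2) = ('C(j, 2) + j)%N by rewrite binS bin1.
transitivity ((q ^+ m * w) ^+ j * q ^+ 'C(j.+1, 2)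
      * (qpoch x q j * qpoch w q j * qpoch (- w) q j * qpoch a q j * qpoch b q j)
      / (qpoch q q j * qpoch C (q ^+ 2) j * qpoch (q ^+ m * w ^+ 2) q j
         * qpoch (A * q ^+ j) q j)
      * (qpoch (a * q ^+ j * q) (q ^+ 2) N * qpoch (b * q ^+ j * q) (q ^+ 2) N
         / (qpoch q (q ^+ 2) N * qpoch (C * (q ^+ 2) ^+ j) (q ^+ 2) N))); last first.
  have Ej t : t * q ^+ j * q = t * q ^+ j.+1 by rewrite exprSr mulrA.
  rewrite /g -/N -/A !Ej; field.
  by rewrite qj Cj wmj Aj qoN CN.
rewrite -H mulr_sumr; apply: eq_bigr => -[p pN] _ /=.
have qp : qpoch q q p != 0 by apply: qpoch_neq0W qN; clear -pN; lia.
have Cp : qpoch (C * (q ^+ 2) ^+ j) (q ^+ 2) p != 0 by apply: qpoch_neq0W CN.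
have wjp : qpoch (q ^+ m * w ^+ 2) q (j + p) != 0.
  by apply/qpoch_neq0P => r rj; apply: wmr; rewrite nE; clear -rj pN; lia.
(* [(A q^(2j+1))_p] supplies the lower parameter [q^(-2(n-j))] of the q-Watson sum for
   [w q^j = q^-(n-j)], while [(q^m w^2 q^j)_p] cancels the tail of [(q^m w^2)_(j+p)]. *)
have As2 : A * q ^+ j.*2.+1 = (w * q ^+ j) ^+ 2.
  by rewrite exprS mulrA -As exprMn -exprM muln2.
have wp : qpoch ((w * q ^+ j) ^+ 2) q p != 0.
  apply/qpoch_neq0P => r rp; rewrite exprMn -exprM -mulrA -exprD; apply: wr.
  by rewrite nE; clear -rp pN; lia.
rewrite /f As2 (prod_sub_expr _ _ xq) C2 [(q ^+ m * w) ^+ j]exprMn.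
rewrite (_ : w ^+ 2 * q ^+ j * q ^+ m = q ^+ m * w ^+ 2 * q ^+ j); last by ring.
move: wjp; rewrite !qpochD mulf_eq0 negb_or => /andP[_ wp'].
rewrite mulNr !exprD.
field.
by rewrite qj Cj wmj Aj qp Cp wp wp'.
Qed.

(** * The removal of [l] *)

(* The well-poised sum with [s = q / a], [e = q^k c / a]; the [i]-th term is the
   [l = 0] parameter pair with [a] replaced by [a q^-i]. *)
Lemma expand_l q a c x l k : q != 0 -> a != 0 -> c != 0 -> x * q ^+ l = 1 ->
    qpoch q q l != 0 -> 1 - q / a ^+ 2 != 0 ->
    qpoch (q ^+ 2 / (a * c)) q l != 0 -> qpoch (q ^+ 2 / a ^+ 2) q l != 0 ->
    qpoch (q ^+ (2 + l) / a ^+ 2) q l != 0 -> qpoch (- q / c) q l != 0 ->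
  qpoch (q ^+ 2 / (a * c)) q l * qpoch (- q / a) q l
    / (qpoch (q ^+ 2 / a ^+ 2) q l * qpoch (- q / c) q l)
  * \sum_(i < l.+1) (q ^+ l.+1) ^+ i * ((- 1) ^+ i / c ^+ i)
      * ((1 - q ^+ (1 + 2 * i) / a ^+ 2) / (1 - q / a ^+ 2))
      * (qpoch x q i * qpoch (c / a) q i * qpoch (q / a ^+ 2) q i
         / (qpoch q q i * qpoch (q ^+ 2 / (a * c)) q i
            * qpoch (q ^+ (2 + l) / a ^+ 2) q i))
      * (qpoch (a * c / q ^+ i.+1) q k * qpoch (c / a * q ^+ i) q k)
  = qpoch (c / a) q k * qpoch (a * c / q ^+ l.+1) q k
    * (qpoch (- c * x * q ^+ k) q l / qpoch (- c * x) q l).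
Proof.
move=> qN0 aN0 cN0 xq ql A0 Xl sl sl2 cl.
pose s := q / a; pose A := q / a ^+ 2; pose X := q ^+ 2 / (a * c).
pose y := a / (c * q ^+ k).
have qk0 : q ^+ k != 0 by rewrite expf_neq0.
have As : s ^+ 2 = A * q by rewrite /s /A; field.
have s2 : q ^+ 2 / a ^+ 2 = s ^+ 2 by rewrite exprMn exprVn.
have s2l : q ^+ (2 + l) / a ^+ 2 = s ^+ 2 * q ^+ l by rewrite exprD -s2 mulrAC.
rewrite s2 s2l in sl sl2 *.
have sr r : (r.+1 < l.*2)%N -> 1 - s ^+ 2 * q ^+ r != 0.
  move=> rl; have /qpoch_neq0P : qpoch (s ^+ 2) q (l + l) != 0 by rewrite qpochD mulf_neq0.
  by apply; rewrite addnn ltnW.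
have nsl : qpoch (- s) q l != 0 by apply: qpoch_opp_neq0.
have nsE : - q / a = - s by rewrite mulNr.
have W := well_poised_sum y As ql sr.
(* All [l] factors are reversed. The case [t = k] handles the numerator on the right-hand side;
   [t = 0] handles its denominator and shows that it is nonzero. *)
have F7 t : qpoch (- (q / c) / q ^+ t) q l * q ^+ 'C(l.+1, 2)
  = (q ^+ l.+1 / c / q ^+ t) ^+ l * qpoch (- c * x * q ^+ t) q l.
  have := qpoch_rev (q := q) (y := - (q / c) / q ^+ t) (z := - c * x * q ^+ t) (leqnn l).
  rewrite subnn qpoch0 mul1r => ->.
    by congr (_ ^+ _ * _); rewrite exprS; field; rewrite cN0 expf_neq0.
  rewrite -[RHS]mulr1 -xq; field.
  by rewrite cN0 expf_neq0.
have syE : - s * y = - (q / c) / q ^+ k.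
  by rewrite /s /y; field; rewrite aN0 cN0 qk0.
have qC0 t : q ^+ t != 0 by rewrite expf_neq0.
have H0 := F7 0; rewrite !expr0 !mulr1 invr1 !mulr1 in H0.
have cx : qpoch (- c * x) q l != 0.
  apply: contraNneq cl => h; move: H0; rewrite h mulr0 => /eqP.
  by rewrite mulf_eq0 (negPf (qC0 _)) orbF mulNr => /eqP->.
have {}syE : qpoch (- s * y) q l * (q ^+ k) ^+ l
    = qpoch (- q / c) q l * (qpoch (- c * x * q ^+ k) q l / qpoch (- c * x) q l).
  apply: (mulIf (qC0 'C(l.+1, 2))).
  rewrite syE [LHS]mulrAC (F7 k) [- q / c]mulNr [RHS]mulrAC H0.
  rewrite [(_ / q ^+ k) ^+ _]exprMn exprVn; field.
  by rewrite cx expf_neq0.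
(* [M] gathers what does not depend on [i], so that the two sums then agree term by term. *)
pose M := qpoch q q l * qpoch (s ^+ 2) q l * qpoch (c / a) q k
  * qpoch (a * c / q ^+ l.+1) q k * (q ^+ k) ^+ l / qpoch X q l.
have -> : \sum_(i < l.+1) (q ^+ l.+1) ^+ i * ((- 1) ^+ i / c ^+ i)
      * ((1 - q ^+ (1 + 2 * i) / a ^+ 2) / (1 - q / a ^+ 2))
      * (qpoch x q i * qpoch (c / a) q i * qpoch (q / a ^+ 2) q i
         / (qpoch q q i * qpoch (q ^+ 2 / (a * c)) q i
            * qpoch (s ^+ 2 * q ^+ l) q i))
      * (qpoch (a * c / q ^+ i.+1) q k * qpoch (c / a * q ^+ i) q k)
  = M * (qpoch (- s * y) q l / (qpoch q q l * qpoch (- s) q l)); last first.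
  rewrite nsE -/X /M.
  transitivity (qpoch (c / a) q k * qpoch (a * c / q ^+ l.+1) q k
     / qpoch (- q / c) q l * (qpoch (- s * y) q l * (q ^+ k) ^+ l)).
    by field; rewrite ql sl cl Xl nsl.
  by rewrite syE; field; rewrite cx cl.
rewrite -W mulr_sumr; apply: eq_bigr => -[i il] _ /=.
rewrite -/A -/X.
have [d lE] : exists d, l = (i + d)%N by exists (l - i)%N; rewrite subnKC.
have qi : qpoch q q i != 0 by apply: qpoch_neq0W ql.
have qd : qpoch q q d != 0 by apply: qpoch_neq0W ql; rewrite lE leq_addl.
have AN e : (0 < e)%N -> (e < l.*2)%N -> 1 - A * q ^+ e != 0.
  by case: e => // e _ el; rewrite exprS mulrA -As; apply: sr.
have Ai : qpoch (A * q ^+ i) q i != 0.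
  by apply/qpoch_neq0P => r ri; rewrite -mulrA -exprD; apply: AN; clear -ri il; lia.
have Ad : qpoch (A * q ^+ i.*2.+1) q d != 0.
  by apply/qpoch_neq0P => r ri; rewrite -mulrA -exprD; apply: AN; clear -ri lE; lia.
have Xi : qpoch X q i != 0 by apply: qpoch_neq0W Xl.
have li : qpoch (s ^+ 2 * q ^+ l) q i != 0 by apply: qpoch_neq0W sl2.
have F1 : \prod_(r < i) (y - q ^+ r) = y ^+ i * qpoch (c / a * q ^+ k) q i.
  apply: prod_sub_expr; rewrite /y; field.
  by rewrite aN0 cN0 qk0.
have F2 : qpoch q q l * q ^+ 'C(i.+1, 2) = qpoch q q d * (- (q * q ^+ l)) ^+ i * qpoch x q i.
  rewrite (qpoch_rev (z := x) (il : (i <= l)%N)) ?lE ?addKn // -lE.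
  by rewrite mulrAC xq mul1r.
(* Both sides equal [(A; q)_(l+i+1)]; the gap in the well-poised denominator is filled by
   [1 - q^(1+2i) / a^2]. *)
have F3 : qpoch (s ^+ 2) q l * qpoch (s ^+ 2 * q ^+ l) q i * (1 - A)
   = qpoch A q i * qpoch (A * q ^+ i) q i * (1 - q ^+ (1 + 2 * i) / a ^+ 2)
     * qpoch (A * q ^+ i.*2.+1) q d.
  rewrite -qpochD As [LHS]mulrC -qpochSl -qpochD addnn mul2n.
  have -> : q ^+ (1 + i.*2) / a ^+ 2 = A * q ^+ i.*2.
    by rewrite add1n [q ^+ _]exprS /A mulrAC.
  by rewrite -qpochS -qpochD; congr (qpoch _ _ _); rewrite lE; clear; lia.
have F4 : qpoch (c / a) q i * qpoch (c / a * q ^+ i) q k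
  = qpoch (c / a) q k * qpoch (c / a * q ^+ k) q i by rewrite -!qpochD addnC.
have F5 : qpoch X q l = qpoch X q i * qpoch (X * q ^+ i) q d by rewrite lE qpochD.
have Xd : qpoch (X * q ^+ i) q d != 0 by move: Xl; rewrite F5 mulf_eq0 negb_or => /andP[].
(* As [Z q^k = X q^i], reversing the two factorials of length [k] turns both sides into splittings
   of [(Z; q)_(k+d)]. *)
have F6 : qpoch (X * q ^+ i) q d * qpoch (a * c / q ^+ i.+1) q k
  = (q ^+ k) ^+ d * qpoch (s ^+ 2 * q ^+ i * y) q d * qpoch (a * c / q ^+ l.+1) q k.
  pose Z := s ^+ 2 * q ^+ i * y.
  have ZX : Z * q ^+ k = X * q ^+ i.
    by rewrite /Z /s /y /X; field; rewrite aN0 cN0 qk0.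
  have Zn : (- (Z * q ^+ k)) ^+ k != 0.
    rewrite ZX expf_neq0 // oppr_eq0 mulf_neq0 // mulf_neq0 ?expf_neq0 //.
    by rewrite invr_eq0 mulf_neq0.
  have := qpoch_rev (q := q) (y := Z) (z := a * c / q ^+ i.+1) (leqnn k).
  have := qpoch_rev (q := q) (y := Z * q ^+ d) (z := a * c / q ^+ l.+1) (leqnn k).
  rewrite subnn !qpoch0 !mul1r => R2 R1.
  have {}R1 := R1 _; have {}R2 := R2 _.
  have ZC : qpoch Z q k * qpoch (Z * q ^+ k) q d = qpoch Z q d * qpoch (Z * q ^+ d) q k.
    by rewrite -!qpochD addnC.
  apply: (mulfI Zn).
  rewrite [LHS]mulrCA -R1; last first.
    by rewrite -mulrA ZX /X exprS; field; rewrite aN0 cN0 qC0.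
  rewrite -ZX mulrA [_ * qpoch Z q k]mulrC ZC -[LHS]mulrA R2; last first.
    have -> : a * c / q ^+ l.+1 * (Z * q ^+ d) * q ^+ k
      = a * c / q ^+ l.+1 * q ^+ d * (Z * q ^+ k) by ring.
    rewrite ZX /X exprS {1}lE exprD; field.
    by rewrite aN0 cN0 !qC0.
  have -> : (- (Z * q ^+ d * q ^+ k)) ^+ k = (- (Z * q ^+ k)) ^+ k * (q ^+ k) ^+ d.
    by rewrite -[(q ^+ k) ^+ d]exprM [(k * d)%N]mulnC exprM -[RHS]exprMn; congr (_ ^+ _); ring.
  by rewrite /Z; ring.
have -> : (l - i)%N = d by rewrite lE addKn.
have xE : qpoch x q i = qpoch q q l * q ^+ 'C(i, 2) * q ^+ i
    / (qpoch q q d * (- 1) ^+ i * (q ^+ l.+1) ^+ i).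
  rewrite -[_ * q ^+ i]mulrA -exprD (_ : 'C(i, 2) + i = 'C(i.+1, 2))%N; last by rewrite binS bin1.
  rewrite F2 -exprS [(- q ^+ l.+1) ^+ i]exprNn.
  have : (- 1) ^+ i != 0 :> F by rewrite signr_eq0.
  have : (q ^+ l.+1) ^+ i != 0 by rewrite expf_neq0.
  move: ((- 1) ^+ i) ((q ^+ l.+1) ^+ i) => e1 e2 e2n e1n; field.
  by rewrite qd e1n e2n.
have sy : s ^+ i * y ^+ i = q ^+ i / (c ^+ i * (q ^+ k) ^+ i).
  rewrite -!exprMn -exprVn -exprMn; congr (_ ^+ _); rewrite /s /y; field.
  by rewrite aN0 cN0 qk0.
have kl : (q ^+ k) ^+ l = (q ^+ k) ^+ i * (q ^+ k) ^+ d by rewrite -exprD -lE.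
have F3' : qpoch A q i * (1 - q ^+ (1 + 2 * i) / a ^+ 2)
   = qpoch (s ^+ 2) q l * qpoch (s ^+ 2 * q ^+ l) q i * (1 - A)
     / (qpoch (A * q ^+ i) q i * qpoch (A * q ^+ i.*2.+1) q d).
  by rewrite F3; move: (1 - q ^+ _ / _) => B; field; rewrite Ai Ad.
have F6' : qpoch (a * c / q ^+ i.+1) q k
  = (q ^+ k) ^+ d * qpoch (s ^+ 2 * q ^+ i * y) q d * qpoch (a * c / q ^+ l.+1) q k
    / qpoch (X * q ^+ i) q d by rewrite -F6; field.
have -> : q ^+ 'C(i, 2) * s ^+ i * \prod_(r < i) (y - q ^+ r)
    = q ^+ 'C(i, 2) * (s ^+ i * y ^+ i) * qpoch (c / a * q ^+ k) q i by rewrite F1 !mulrA.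
rewrite sy /M kl F5.
transitivity ((q ^+ l.+1) ^+ i * ((- 1) ^+ i / c ^+ i) / (1 - A)
  * (qpoch x q i / (qpoch q q i * qpoch X q i * qpoch (s ^+ 2 * q ^+ l) q i))
  * (qpoch A q i * (1 - q ^+ (1 + 2 * i) / a ^+ 2))
  * (qpoch (c / a) q i * qpoch (c / a * q ^+ i) q k) * qpoch (a * c / q ^+ i.+1) q k).
  by move: (1 - q ^+ _ / _) => B; ring.
rewrite F3' F4 F6' xE.
have : (- 1) ^+ i != 0 :> F by rewrite signr_eq0.
have : (q ^+ l.+1) ^+ i != 0 by rewrite expf_neq0.
have : c ^+ i != 0 by rewrite expf_neq0.
have : (q ^+ k) ^+ i != 0 by rewrite expf_neq0.
move: ((- 1) ^+ i) ((q ^+ l.+1) ^+ i) (c ^+ i) ((q ^+ k) ^+ i) => e1 e2 e3 e4.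
move=> e4n e3n e2n e1n.
move: (qpoch (a * c / q ^+ l.+1) q k) (qpoch (c / a * q ^+ k) q i) (qpoch (c / a) q k).
move: Xi Xd Ai Ad A0 qi qd li; rewrite -/A.
move: (qpoch X q i) (qpoch (X * _) q d) (qpoch (A * q ^+ i) q i) (qpoch (A * _) q d).
move: (1 - A) (qpoch q q i) (qpoch q q d) (qpoch (s ^+ 2 * q ^+ l) q i).
clear -e1n e2n e3n e4n => *.
by field; do ![apply/andP; split].
Qed.

(** * Assembly *)

(** Here [w = q^-n] and [f = q^(1-n) / v]; after reversing both, [q^C(k+1,2)] and [(-q^n)^k] cancel
    in the quotient. This converts a series to the form of [sears], and the result of [sears] back
    into a series. *)
Lemma qpoch_ratio_rev q w v f n k : (k <= n)%N -> q != 0 -> v != 0 ->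
    w * q ^+ n = 1 -> f * v * q ^+ n = q -> qpoch q q n != 0 -> qpoch v q n != 0 ->
  qpoch w q k / qpoch f q k * q ^+ k
  = qpoch q q n / qpoch v q n * (qpoch v q (n - k) / qpoch q q (n - k)) * v ^+ k.
Proof.
move=> kn q0 v0 wq fvq qn vn.
have H1 : w * q * q ^+ n = q by rewrite mulrAC wq mul1r.
have := qpoch_rev kn H1; have := qpoch_rev kn fvq.
rewrite -!mulrN !exprMn; set c := q ^+ 'C(_, _); set N := (- q ^+ n) ^+ k => e2 e1.
have c0 : c != 0 by rewrite expf_neq0.
have N0 : N != 0 by rewrite expf_neq0 // oppr_eq0 expf_neq0.
have qk0 : q ^+ k != 0 by rewrite expf_neq0.
have vk0 : v ^+ k != 0 by rewrite expf_neq0.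
have qnk : qpoch q q (n - k) != 0 by apply: qpoch_neq0W qn; apply: leq_subr.
have vnk : qpoch v q (n - k) != 0 by apply: qpoch_neq0W vn; apply: leq_subr.
have -> : qpoch w q k = qpoch q q n * c / (qpoch q q (n - k) * (q ^+ k * N)).
  by rewrite e1; field; rewrite qnk qk0 N0.
have -> : qpoch f q k = qpoch v q n * c / (qpoch v q (n - k) * (v ^+ k * N)).
  by rewrite e2; field; rewrite vnk vk0 N0.
field.
by rewrite qnk vnk qk0 vk0 N0 c0 vn.
Qed.

Lemma exprz_subn q (i j : nat) : q != 0 -> q ^ (i%:Z - j%:Z) = q ^+ i / q ^+ j.
Proof. by move=> q0; rewrite expfzDr // -exprnP -exprnN. Qed.

Lemma phi43_double_sum (q a c : F) (l m n : nat)
  (q_neq0 : q != 0) (a_neq0 : a != 0) (c_neq0 : c != 0) (le_mn : (m <= n)%N)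
  (den_lhs : forall k : nat, (k <= n)%N ->
     qpochs [:: q; c; q ^ (1 + l%:Z + m%:Z - 2 * n%:Z) / c; - q] q k != 0)
  (den_pre_l : qpochs [:: q ^+ 2 / a ^+ 2; - q / c] q l != 0)
  (den_pre_n : qpochs [:: q ^ (n%:Z - m%:Z - l%:Z) * c; - q] q n != 0)
  (den_T0 : 1 - q / a ^+ 2 != 0)
  (den_Ti : forall i : nat, (i <= l)%N ->
     qpochs [:: q; q ^+ 2 / (a * c); q ^+ (2 + l) / a ^+ 2] q i != 0)
  (den_Tj : forall j : nat, (j <= m)%N ->
     qpochs [:: q; c; - c; q ^ (m%:Z - 2 * n%:Z);
                q ^ (j%:Z - 2 * n%:Z - 1)] q j != 0)
  (den_Tnj : forall j : nat, (j <= m)%N ->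
     qpochs [:: q; q ^+ (2 * j) * c ^+ 2] (q ^+ 2) (n - j) != 0) :
  phi43 n a (q ^+ (1 + l) / a) (q ^ (- n%:Z)) (- q ^ (m%:Z - n%:Z))
        c (q ^ (1 + l%:Z + m%:Z - 2 * n%:Z) / c) (- q) q q
  = qpochs [:: q ^+ 2 / (a * c); - q / a] q l
    / qpochs [:: q ^+ 2 / a ^+ 2; - q / c] q l
    * (qpochs [:: q ^ (1 - m%:Z + n%:Z); - q ^ (- l%:Z) * c] q n
       / qpochs [:: q ^ (n%:Z - m%:Z - l%:Z) * c; - q] q n)
    * \sum_(i < l.+1) \sum_(j < m.+1) Tterm q a c l m n i j.
Proof.
set w := (q ^+ n)^-1; set x := (q ^+ l)^-1; set y := (q ^+ m)^-1.
have qk0 k : q ^+ k != 0 by rewrite expf_neq0.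
have wq : w * q ^+ n = 1 by rewrite mulVf.
have xq : x * q ^+ l = 1 by rewrite mulVf.
have yq : y * q ^+ m = 1 by rewrite mulVf.
have Ewn : q ^ (- n%:Z) = w by rewrite -exprnN.
have Exl : q ^ (- l%:Z) = x by rewrite -exprnN.
have Eym : q ^ (- m%:Z) = y by rewrite -exprnN.
have Emn : q ^ (m%:Z - n%:Z) = q ^+ m * w by rewrite exprz_subn.
have Emn2 : q ^ (m%:Z - 2 * n%:Z) = q ^+ m * w ^+ 2.
  by rewrite (_ : _ - 2 * n%:Z = m%:Z - (n * 2)%:Z) ?exprz_subn ?exprM ?exprVn //; lia.
pose f := q ^+ (1 + l) * (q ^+ m * w ^+ 2) / c.
have Ef : q ^ (1 + l%:Z + m%:Z - 2 * n%:Z) / c = f.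
  rewrite (_ : 1 + l%:Z + m%:Z - 2 * n%:Z = (1 + l + m)%:Z - (n * 2)%:Z); last by lia.
  by rewrite exprz_subn // exprD exprM -exprVn -mulrA.
pose v := q ^+ n / (q ^+ m * q ^+ l) * c.
have Ev : q ^ (n%:Z - m%:Z - l%:Z) * c = v.
  by rewrite (_ : n%:Z - m%:Z - l%:Z = n%:Z - (m + l)%:Z) ?exprz_subn ?exprD //; lia.
pose V := q ^+ n.+1 / q ^+ m.
have EV : q ^ (1 - m%:Z + n%:Z) = V.
  by rewrite (_ : 1 - m%:Z + n%:Z = n.+1%:Z - m%:Z) ?exprz_subn //; lia.
have Eji i j : q ^ (j%:Z - i%:Z) * a * c = a * c / q ^+ i.+1 * q ^+ j.+1.
  rewrite exprz_subn // !exprS; field.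
  by rewrite qk0.
have Ei i : q ^ (- i%:Z - 1) * a * c = a * c / q ^+ i.+1.
  rewrite (_ : - i%:Z - 1 = 0%:Z - i.+1%:Z) ?exprz_subn //; last by lia.
  by rewrite expr0 mul1r -mulrA mulrC.
have Ej j : q ^ (j%:Z - 2 * n%:Z - 1) = w ^+ 2 / q * q ^+ j.
  rewrite (_ : j%:Z - 2 * n%:Z - 1 = j%:Z - (n * 2).+1%:Z) ?exprz_subn //; last by lia.
  by rewrite exprS exprM /w; field; rewrite qk0 q_neq0.
rewrite {}Ewn {}Emn {}Ef {}Ev {}EV in den_lhs den_pre_n *.
rewrite /qpochs in den_lhs den_pre_l den_pre_n den_Ti den_Tnj.
have := den_lhs n (leqnn n); have := den_Ti l (leqnn l); have := den_Tnj 0 (leq0n m).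
move: den_pre_l den_pre_n.
rewrite !big_cons !big_nil !mulr1 !mulf_eq0 !negb_or muln0 expr0 mul1r subn0.
case/andP=> sl cl /andP[vn q'n] /andP[qon Cn] /and3P[ql Xl sl2] /and4P[qn cn fn _].
(* [(q; q)_(2n) = (q; q^2)_n (q; q)_n (-q; q)_n], and each of the three occurs in a displayed
   denominator. *)
have q2n : qpoch q q n.*2 != 0.
  by rewrite qpoch_double -expr2 -qpoch_sqr !mulf_neq0.
have c'n : qpoch (- c) q n != 0.
  by move: Cn; rewrite -qpoch_sqr mulf_eq0 negb_or => /andP[].
have w0 : w != 0 by rewrite invr_eq0.
have v0 : v != 0 by rewrite mulf_neq0 // mulf_neq0 // invr_eq0 mulf_neq0.
have V0 : V != 0 by rewrite mulf_neq0 // invr_eq0.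
have VE : V = q ^+ (n - m).+1.
  by apply: (mulIf (qk0 m)); rewrite divfK // -exprD addSn subnK.
have Vn : qpoch V q n != 0.
  apply/qpoch_neq0P => r rn; rewrite VE exprS -mulrA -exprD.
  have /qpoch_neq0P := q2n; apply.
  by rewrite -addnn -addnS leq_add ?leq_subr.
have fV : f * v * q ^+ n = q.
  by rewrite /f /v /w add1n [q ^+ l.+1]exprS; field; rewrite c_neq0 !qk0.
have fV2 : q ^+ m * w ^+ 2 * V * q ^+ n = q.
  by rewrite /V /w [q ^+ n.+1]exprS; field; rewrite !qk0.
(* Solved from [x u = q^(l+1) / a], [z u = a], [x z u = c] in [sears], with [b] as its [x] and [A]
   as its [a]. Since [v = q^(1-n) / f], the balancing condition becomes [A u v = -q]. *)
pose A := - (q ^+ m * w); pose b := c / a; pose z := a * c / q ^+ l.+1.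
pose u := q ^+ l.+1 / c.
have bu : b * u = q ^+ (1 + l) / a by rewrite /b /u; field; rewrite c_neq0 a_neq0.
have zu : z * u = a by rewrite /z /u; field; rewrite c_neq0 qk0.
have bzu : b * z * u = c by rewrite -mulrA zu /b; field.
have Auv : A * u * v = - q.
  by rewrite /A /u /v /w [q ^+ l.+1]exprS; field; rewrite c_neq0 !qk0.
have Av : A * v = - c * x.
  by rewrite /A /v /w /x; field; rewrite !qk0.
have uv : u * v = V.
  by rewrite /u /v /V !exprS; field; rewrite c_neq0 !qk0.
have -> : phi43 n a (q ^+ (1 + l) / a) w A c f (- q) q q
  = qpoch q q n / qpoch v q n * \sum_(k < n.+1) qpoch A q k * qpoch (b * u) q k
      * qpoch (z * u) q k
      / (qpoch q q k * qpoch (b * z * u) q k * qpoch (A * u * v) q k)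
      * (qpoch v q (n - k) / qpoch q q (n - k)) * v ^+ k.
  rewrite mulr_sumr; apply: eq_bigr => -[k kn] _ /=.
  rewrite bu zu bzu Auv /qpochs !big_cons !big_nil !mulr1.
  have := qpoch_ratio_rev (kn : (k <= n)%N) q_neq0 v0 wq fV qn vn.
  have qk : qpoch q q k != 0 by apply: qpoch_neq0W qn.
  have ck : qpoch c q k != 0 by apply: qpoch_neq0W cn.
  have fk : qpoch f q k != 0 by apply: qpoch_neq0W fn.
  have q'k : qpoch (- q) q k != 0 by apply: qpoch_neq0W q'n.
  move=> /(congr1 (fun t => qpoch a q k * qpoch (q ^+ (1 + l) / a) q k * qpoch A q k
    / (qpoch q q k * qpoch c q k * qpoch (- q) q k) * t)) H.
  transitivity (qpoch a q k * qpoch (q ^+ (1 + l) / a) q k * qpoch A q k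
    / (qpoch q q k * qpoch c q k * qpoch (- q) q k)
    * (qpoch w q k / qpoch f q k * q ^+ k)).
    by field; rewrite qk ck fk q'k.
  rewrite H; field.
  by rewrite qk ck q'k vn (qpoch_neq0W _ qn) ?leq_subr.
rewrite sears ?Auv ?bzu // Av uv.
pose P := qpoch (q ^+ 2 / (a * c)) q l * qpoch (- q / a) q l
    / (qpoch (q ^+ 2 / a ^+ 2) q l * qpoch (- q / c) q l).
(* [W i] is the coefficient in [expand_l]. [U i j] is the [j]-th term of [phi_expand_m] for the pair
   [a c / q^(i+1)], [q^i c / a], which has [C = c^2] for every [i]. *)
pose W i := (q ^+ l.+1) ^+ i * ((- 1) ^+ i / c ^+ i)
      * ((1 - q ^+ (1 + 2 * i) / a ^+ 2) / (1 - q / a ^+ 2))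
      * (qpoch x q i * qpoch (c / a) q i * qpoch (q / a ^+ 2) q i
         / (qpoch q q i * qpoch (q ^+ 2 / (a * c)) q i
            * qpoch (q ^+ (2 + l) / a ^+ 2) q i)).
pose U i j := (q ^+ m * w) ^+ j * q ^+ 'C(j.+1, 2)
      * (qpoch y q j * qpoch w q j * qpoch (- w) q j
         * qpoch (a * c / q ^+ i.+1) q j * qpoch (b * q ^+ i) q j)
      / (qpoch q q j * qpoch (c ^+ 2) (q ^+ 2) j * qpoch (q ^+ m * w ^+ 2) q j
         * qpoch (w ^+ 2 / q * q ^+ j) q j)
      * (qpoch (a * c / q ^+ i.+1 * q ^+ j.+1) (q ^+ 2) (n - j)
         * qpoch (b * q ^+ i * q ^+ j.+1) (q ^+ 2) (n - j))
      / (qpoch q (q ^+ 2) (n - j) * qpoch (c ^+ 2 * (q ^+ 2) ^+ j) (q ^+ 2) (n - j)).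
have TE i j : Tterm q a c l m n i j = W i * U i j.
  rewrite /Tterm /qpochs !big_cons !big_nil !mulr1 Exl Eym -!exprnN -/w Emn2 Ej Ei Eji.
  have -> : q ^ ((l%:Z + 1) * i%:Z + (m%:Z - n%:Z) * j%:Z + 'C(j.+1, 2)%:Z)
      = (q ^+ l.+1) ^+ i * (q ^+ m * w) ^+ j * q ^+ 'C(j.+1, 2).
    rewrite !expfzDr // -!exprz_exp exprz_subn //.
    by rewrite (_ : l%:Z + 1 = l.+1%:Z) // -addn1 PoszD.
  have -> : q ^+ i * c / a = b * q ^+ i by rewrite /b; ring.
  have -> : q ^+ (1 + i + j) * c / a = b * q ^+ i * q ^+ j.+1.
    by rewrite add1n addSnnS exprD /b; ring.
  rewrite exprM [_ * c ^+ 2]mulrC /W /U -qpoch_sqr !invfM; ring.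
have UE i : \sum_(j < m.+1) U i j
  = \sum_(k < n.+1) qpoch w q k * qpoch A q k * qpoch (a * c / q ^+ i.+1) q k
      * qpoch (b * q ^+ i) q k
      / (qpoch q q k * qpoch (c ^+ 2) (q ^+ 2) k * qpoch (q ^+ m * w ^+ 2) q k) * q ^+ k.
  rewrite (phi_expand_m (m := m) wq yq) //.
  by rewrite /b exprS; field; rewrite a_neq0 qk0.
rewrite /qpochs !big_cons !big_nil !mulr1 Exl -/P.
have -> : \sum_(i < l.+1) \sum_(j < m.+1) Tterm q a c l m n i j
  = \sum_(k < n.+1) qpoch w q k * qpoch A q k
      / (qpoch q q k * qpoch (c ^+ 2) (q ^+ 2) k * qpoch (q ^+ m * w ^+ 2) q k) * q ^+ k
    * \sum_(i < l.+1) W i * (qpoch (a * c / q ^+ i.+1) q k * qpoch (b * q ^+ i) q k).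
  transitivity (\sum_(i < l.+1) W i * \sum_(j < m.+1) U i j).
    by apply: eq_bigr => i _; rewrite mulr_sumr; apply: eq_bigr => j _; apply: TE.
  under eq_bigr => i _ do rewrite UE mulr_sumr.
  rewrite exchange_big; apply: eq_bigr => k _; rewrite mulr_sumr.
  by apply: eq_bigr => i _; ring.
rewrite !mulr_sumr; apply: eq_bigr => -[k kn] _ /=.
have H := expand_l k q_neq0 a_neq0 c_neq0 xq ql den_T0 Xl sl sl2 cl.
have cx : qpoch (- c * x) q l != 0.
  have : - c * x * (- q / c) * q ^+ l = q by rewrite /x; field; rewrite c_neq0 qk0.
  move=> /(qpoch_rev (leqnn l)) h; apply: contraNneq cl => h0; move/eqP: h.
  by rewrite h0 mulr0 mulf_eq0 (negPf (qk0 _)) orbF.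
have c'k : qpoch (- c) q k != 0 by apply: qpoch_neq0W c'n.
(* Two splittings of [(-c x)_(k+l)], with [x q^l = 1], trade the factor left by Sears for [(-c)_k],
   which joins [(c)_k] to give [(c^2; q^2)_k]. *)
have K1 : qpoch (- c * x * q ^+ k) q (n - k)
  = qpoch (- c * x) q n * qpoch (- c * x * q ^+ k) q l
    / (qpoch (- c * x) q l * qpoch (- c) q k).
  have e : qpoch (- c * x) q l * qpoch (- c) q k
      = qpoch (- c * x) q k * qpoch (- c * x * q ^+ k) q l.
    by rewrite -qpochD addnC qpochD -[_ * x * _]mulrA xq mulr1.
  rewrite -{2}(subnKC (kn : (k <= n)%N)) qpochD e; field.
  have := mulf_neq0 cx c'k; rewrite e mulf_eq0 negb_or => /andP[e1 e2].
  by rewrite e1 e2.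
have ck : qpoch c q k != 0 by apply: qpoch_neq0W cn.
have qk : qpoch q q k != 0 by apply: qpoch_neq0W qn.
have qnk : qpoch q q (n - k) != 0 by apply: qpoch_neq0W qn; apply: leq_subr.
have R := qpoch_ratio_rev (kn : (k <= n)%N) q_neq0 V0 wq fV2 qn Vn.
transitivity (qpoch (- c * x) q n / (qpoch v q n * qpoch (- q) q n)
  * (qpoch A q k / (qpoch q q k * (qpoch c q k * qpoch (- c) q k)))
  * (qpoch V q n * (qpoch w q k / qpoch (q ^+ m * w ^+ 2) q k * q ^+ k))
  * (P * \sum_(i < l.+1) W i * (qpoch (a * c / q ^+ i.+1) q k * qpoch (b * q ^+ i) q k))).
  rewrite {}H {}R K1 -/b -/z; field.
  by rewrite cx qnk Vn c'k ck qk q'n vn.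
rewrite qpoch_sqr (_ : - x * c = - c * x); last by ring.
rewrite !invfM; ring.
Qed.

End QSeries.

Theorem mainTheorem13 (R : realType) (q a c : R[i]) (l m n : nat)
  (q_neq0 : q != 0) (a_neq0 : a != 0) (c_neq0 : c != 0) (le_mn : (m <= n)%N)
  (* no zero factor in the denominators of the left-hand side *)
  (den_lhs : forall k : nat, (k <= n)%N ->
     qpochs [:: q; c; q ^ (1 + l%:Z + m%:Z - 2 * n%:Z) / c; - q] q k != 0)
  (* ... of the prefactor *)
  (den_pre_l : qpochs [:: q ^+ 2 / a ^+ 2; - q / c] q l != 0)
  (den_pre_n : qpochs [:: q ^ (n%:Z - m%:Z - l%:Z) * c; - q] q n != 0)
  (* ... and of the terms T_{i,j}, 0 <= i <= l, 0 <= j <= m *)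
  (den_T0 : 1 - q / a ^+ 2 != 0)
  (den_Ti : forall i : nat, (i <= l)%N ->
     qpochs [:: q; q ^+ 2 / (a * c); q ^+ (2 + l) / a ^+ 2] q i != 0)
  (den_Tj : forall j : nat, (j <= m)%N ->
     qpochs [:: q; c; - c; q ^ (m%:Z - 2 * n%:Z);
                q ^ (j%:Z - 2 * n%:Z - 1)] q j != 0)
  (den_Tnj : forall j : nat, (j <= m)%N ->
     qpochs [:: q; q ^+ (2 * j) * c ^+ 2] (q ^+ 2) (n - j) != 0) :
  phi43 n a (q ^+ (1 + l) / a) (q ^ (- n%:Z)) (- q ^ (m%:Z - n%:Z))
        c (q ^ (1 + l%:Z + m%:Z - 2 * n%:Z) / c) (- q) q q
  = qpochs [:: q ^+ 2 / (a * c); - q / a] q l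
    / qpochs [:: q ^+ 2 / a ^+ 2; - q / c] q l
    * (qpochs [:: q ^ (1 - m%:Z + n%:Z); - q ^ (- l%:Z) * c] q n
       / qpochs [:: q ^ (n%:Z - m%:Z - l%:Z) * c; - q] q n)
    * \sum_(i < l.+1) \sum_(j < m.+1) Tterm q a c l m n i j.
Proof. exact: phi43_double_sum. Qed.
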